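(* Let $k\ge 4$ and let $\mathbf f$ be a sequence of transpositions in $\mathrm{Sym}(k)$ whose transpositional multigraph $\mathcal T(\mathbf f)$ is connected on the vertex set $k$ and contains a circuit. Then $\mathbf f$ is not conjugacy invariant.
   Context: $k=\{0,\ldots,k-1\}$; permutations compose left to right. For a finite sequence $\mathbf s$ in $\mathrm{Sym}(k)$, $\bigcirc\mathbf s$ is the composite of its terms in order, $\mathrm{Seq}(\mathbf s)$ its set of rearrangements and $\mathrm{Prod}(\mathbf s)=\{\bigcirc\mathbf r:\mathbf r\in\mathrm{Seq}(\mathbf s)\}$; $\mathbf s$ is conjugacy invariant iff every element of $\mathrm{Prod}(\mathbf s)$ is conjugate to $\bigcirc\mathbf s$. $\mathcal T(\mathbf f)$ is the multigraph on vertex set $k$ in which the multiedge $(x\,y)$ has multiplicity equal to the number of terms of $\mathbf f$ equal to $(x\,y)$. ''Contains a circuit'' means the underlying simple graph contains a cycle $v_1,v_2,\ldots,v_m,v_1$ with $m\ge 3$ distinct vertices. *)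

(* Defs.v *)
From mathcomp Require Import all_boot all_fingroup.

Set Implicit Arguments.
Unset Strict Implicit.
Unset Printing Implicit Defensive.

Local Open Scope group_scope.

Section Sequences.

Variable k : nat.
Implicit Types (s r f : seq 'S_k) (p q : 'S_k).

(* The product of {perm T} satisfies (p * q) x = q (p x), so this is the
   left-to-right composite of the terms in order. *)
Definition composite s : 'S_k := \prod_(p <- s) p.

Definition Seq s : pred (seq 'S_k) := [pred r | perm_eq r s].

Definition Prod s p : Prop := exists2 r, r \in Seq s & p = composite r.

Definition conjugate p q : Prop := exists g : 'S_k, p = q ^ g.

Definition conjugacy_invariant s : Prop :=
  forall p, Prod s p -> conjugate p (composite s).

Definition transposition p : Prop :=
  exists x y : 'I_k, x != y /\ p = tperm x y.

End Sequences.

(* A loopless multigraph is given by its edge multiplicities, as a symmetric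
   function vanishing on the diagonal. *)
Record multigraph (V : finType) := Multigraph {
  mult :> V -> V -> nat;
  mult_sym : forall x y, mult x y = mult y x;
  mult_irr : forall x, mult x x = 0
}.

Section Multigraphs.

Variables (V : finType) (G : multigraph V).

Definition adj : rel V := [rel x y | 0 < G x y].

Definition connected : Prop := forall x y : V, connect adj x y.

(* ucycle adj c: the vertices of c are distinct, consecutive ones are adjacent,
   and the last is adjacent to the first. *)
Definition contains_circuit : Prop :=
  exists c : seq V, 3 <= size c /\ ucycle adj c.

End Multigraphs.

Section TranspositionalMultigraph.

Variables (k : nat) (f : seq 'S_k).

Definition tmult (x y : 'I_k) : nat :=
  if x == y then 0 else count_mem (tperm x y) f.

Fact tmult_sym x y : tmult x y = tmult y x.
Proof. by rewrite /tmult eq_sym tpermC. Qed.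

Fact tmult_irr x : tmult x x = 0.
Proof. by rewrite /tmult eqxx. Qed.

Definition transpositional_multigraph : multigraph 'I_k :=
  Multigraph tmult_sym tmult_irr.

End TranspositionalMultigraph.

(* Main.v *)
Require Import Defs.
From mathcomp Require Import all_boot all_fingroup zify.

Set Implicit Arguments.
Unset Strict Implicit.
Unset Printing Implicit Defensive.

Local Open Scope group_scope.

(** Write products of permutations from left to right. If [s] is a permutation
    and [a, b, c, d] are distinct points, the permutations [(a b)s], [(a c)s],
    [(b c)s], [(b d)s], [(c d)s] and [(d c b a)s] are not all conjugate. Counting
    cycles, the first five force the four points to lie on one cycle of [s], or
    [a, b, c] and [b, c, d] to lie on three different cycles each. On a single
    cycle, comparing the lengths of the two pieces cut off by each transposition,
    both [a, b, c] and [b, c, d] would divide the cycle into thirds, whence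
    [a = d]. On different cycles, the cycles of [a, b, c] have the same length [L],
    and the 4-cycle either merges four cycles, or [a] and [d] share a cycle of
    length [L] and the 4-cycle cuts off a piece shorter than [L].

    All six permutations occur in [Prod f] up to conjugacy with a common [s]. For a
    triangle [a, b, c] with a further edge [a d], take [s = (a d) D] where [D] is
    the product of the remaining terms, since the product of the three triangle
    edges is the middle one. For a circuit [a, b, c, d, ...] of length at least 4,
    take [s = (b c)(c d) rho D] where [rho] is the product of the circuit edges
    leading from [d] back to [a]. *)

(** * Cycle lengths under conjugation and under multiplication by a transposition *)

Section Orbits.

Variable T : finType.
Implicit Types (s u g : {perm T}) (x y z w : T) (O : {set T}).

Lemma eq_porbit s x y : x \in porbit s y -> porbit s x = porbit s y.
Proof. by rewrite -eq_porbit_mem => /eqP. Qed.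

Lemma porbitJ s g x : porbit (s ^ g) (g x) = g @: porbit s x.
Proof.
apply/setP=> z; apply/porbitP/imsetP => [[i ->]|[_ /porbitP[i ->] ->]].
  by exists ((s ^+ i) x); rewrite ?mem_porbit // -conjXg permJ.
by exists i; rewrite -conjXg permJ.
Qed.

Lemma card_porbitJ s g x : #|porbit (s ^ g) (g x)| = #|porbit s x|.
Proof. by rewrite porbitJ card_imset //; apply: perm_inj. Qed.

Lemma card_porbitsJ s g : #|porbits (s ^ g)| = #|porbits s|.
Proof.
rewrite -[RHS](card_imset _ (imset_inj (@perm_inj _ g))); congr #|pred_of_set _|.
apply/setP=> A; apply/imsetP/imsetP => [[x _ ->]|[_ /imsetP[x _ ->] ->]].
  exists (porbit s (g^-1 x)); first exact: imset_f.
  by rewrite -porbitJ permKV.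
by exists (g x); rewrite // porbitJ.
Qed.

(** Conjugate permutations have equally many points on cycles of each length. When cycle lengths
    agree pointwise off [O], these counts also agree within [O]. *)
Lemma card_porbit_transfer s g u O x :
    u = s ^ g -> (forall z, z \notin O -> #|porbit s z| = #|porbit u z|) ->
  x \in O -> exists2 y, y \in O & #|porbit s y| = #|porbit u x|.
Proof.
move=> us out Ox; set n := #|porbit u x|.
pose A (v : {perm T}) := [set z | #|porbit v z| == n].
have eqA : #|A u| = #|A s|.
  rewrite -[RHS](card_imset _ (@perm_inj _ g)); congr #|pred_of_set _|.
  apply/setP=> z; rewrite -[z](permKV g) (mem_imset _ _ (@perm_inj _ g)) !inE.
  by rewrite us card_porbitJ.
have eqD : A u :\: O = A s :\: O.
  by apply/setP=> z; rewrite !inE; case: (boolP (z \in O)) => //= /out ->.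
have: 0 < #|A s :&: O|.
  have: #|A u :&: O| = #|A s :&: O|.
    by move: eqA; rewrite -(cardsID O (A u)) -(cardsID O (A s)) eqD => /addIn.
  by move=> <-; rewrite card_gt0; apply/set0Pn; exists x; rewrite !inE eqxx.
rewrite card_gt0 => /set0Pn[y]; rewrite !inE => /andP[/eqP sy Oy].
by exists y.
Qed.

Lemma perm_expD s i j x : (s ^+ (i + j)) x = (s ^+ j) ((s ^+ i) x).
Proof. by rewrite expgD permM. Qed.

Lemma card_porbit_gt0 s x : 0 < #|porbit s x|.
Proof. by rewrite lt0n card_porbit_neq0. Qed.

Lemma expg_card_porbit s x : (s ^+ #|porbit s x|) x = x.
Proof. by rewrite permX iter_porbit. Qed.

Lemma porbit_expg_inj s x i j :
  i < #|porbit s x| -> j < #|porbit s x| -> (s ^+ i) x = (s ^+ j) x -> i = j.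
Proof.
move=> lti ltj eqij; apply/eqP.
rewrite -(nth_uniq x _ _ (uniq_traject_porbit s x)) ?size_traject //.
by rewrite !nth_traject // -!permX eqij.
Qed.

Lemma porbitPlt s x y :
  y \in porbit s x -> exists2 i, i < #|porbit s x| & y = (s ^+ i) x.
Proof.
by rewrite porbit_traject => /trajectP[i lti ->]; exists i; rewrite // permX.
Qed.

Lemma card_porbit_first_return s x i :
    0 < i -> (s ^+ i) x = x ->
    (forall j, 0 < j < i -> (s ^+ j) x != x) ->
  #|porbit s x| = i.
Proof.
move=> i_gt0 six first; case: (ltngtP #|porbit s x| i) => // ltn.
  have /first/eqP[] : 0 < #|porbit s x| < i by rewrite card_porbit_gt0.
  exact: expg_card_porbit.
have := @porbit_expg_inj s x i 0 ltn (card_porbit_gt0 s x).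
by rewrite expg0 perm1 six => /(_ erefl) i0; rewrite i0 in i_gt0.
Qed.

Section Detour.

Variables (s u : {perm T}) (x y : T) (i : nat).
Hypothesis uy : u y = s x.
Hypothesis us : forall j, 0 < j < i -> u ((s ^+ j) x) = s ((s ^+ j) x).

(** One step of [u] from [y] lands on [s x]; from then on [u] shadows the [s]-trajectory of [x]. The
    same mechanism serves merging, splitting and the 4-cycle. *)
Lemma detour_expg j : 0 < j <= i -> (u ^+ j) y = (s ^+ j) x.
Proof.
elim: j => // -[|j] IHj; first by rewrite !expg1.
by move=> /andP[_ lt_ji]; rewrite expgSr [s ^+ _]expgSr !permM IHj ?us //= ltnW.
Qed.

Hypothesis i_gt0 : 0 < i.
Hypothesis six : (s ^+ i) x = y.
Hypothesis first : forall j, 0 < j < i -> (s ^+ j) x != y.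

Lemma card_porbit_detour : #|porbit u y| = i.
Proof.
apply: card_porbit_first_return => // [|j /andP[j_gt0 lt_ji]].
  by rewrite detour_expg ?i_gt0 /=.
by rewrite detour_expg ?j_gt0 ?first // ?j_gt0 // ltnW.
Qed.

End Detour.

Lemma eq_porbit_on s u z :
  (forall w, w \in porbit s z -> u w = s w) -> porbit u z = porbit s z.
Proof.
move=> us; have e j : (u ^+ j) z = (s ^+ j) z.
  elim: j => [|j IHj]; first by rewrite !expg0.
  by rewrite !expgSr !permM IHj us ?mem_porbit.
by apply/setP=> w; apply/porbitP/porbitP=> -[j ->]; exists j.
Qed.

Lemma porbit_tperm_out s x y z :
  x \notin porbit s z -> y \notin porbit s z ->
  porbit (tperm x y * s) z = porbit s z.
Proof.
move=> xz yz; apply: eq_porbit_on => w wz; rewrite permM tpermD //.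
  by apply: contraNneq xz => ->.
by apply: contraNneq yz => ->.
Qed.

Lemma porbit_closed u O x :
  (forall w, w \in O -> u w \in O) -> x \in O -> porbit u x \subset O.
Proof.
move=> cl Ox; apply/subsetP=> _ /porbitP[i ->].
by elim: i => [|i IHi]; rewrite ?expg0 ?perm1 // expgSr permM cl.
Qed.

Lemma mem_porbit_perm s x z : (s z \in porbit s x) = (z \in porbit s x).
Proof.
by rewrite -!eq_porbit_mem -[s z]/((s ^+ 1) z) porbit_perm.
Qed.

(** The product sends [x] to [s y] and then runs through the whole cycle of [y]: [x] is not on it,
    and [y] is met again only at the end. *)
Lemma porbit_tperm_sub s x y :
  x \notin porbit s y -> porbit s y \subset porbit (tperm x y * s) x.
Proof.
move=> xNy; apply/subsetP=> _ /porbitPlt[j ltj ->].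
set u := tperm x y * s; set n := #|porbit s y|.
have run m : 0 < m <= n -> (u ^+ m) x = (s ^+ m) y.
  move=> lemn; apply: detour_expg lemn => [|l /andP[l_gt0 ltln]].
    by rewrite permM tpermL.
  rewrite permM tpermD //; first by apply: contraNneq xNy => ->; rewrite mem_porbit.
  apply/eqP=> /esym eqy; have := @porbit_expg_inj s y l 0 ltln (card_porbit_gt0 s y).
  by rewrite expg0 perm1 eqy => /(_ erefl) l0; rewrite l0 in l_gt0.
(* [run] starts at exponent 1, so [y] itself is recovered as the point at exponent [n]. *)
case: j ltj => [_|j ltj]; last by rewrite -run ?mem_porbit //= ltnW.
rewrite expg0 perm1 -[X in X \in _](expg_card_porbit s y) -run ?mem_porbit //.
by rewrite card_porbit_gt0 leqnn.
Qed.

Lemma porbit_tperm_merge s x y :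
  x \notin porbit s y ->
  porbit (tperm x y * s) x = porbit s x :|: porbit s y.
Proof.
move=> xNy; have yNx : y \notin porbit s x by rewrite porbit_sym.
have sub1 := porbit_tperm_sub xNy; have sub2 := porbit_tperm_sub yNx.
apply/eqP; rewrite eqEsubset; apply/andP; split.
  apply: porbit_closed; last by rewrite inE porbit_id.
  move=> w; rewrite !inE permM.
  by case: tpermP => [->|->|_ _]; rewrite !mem_porbit_perm ?porbit_id ?orbT.
rewrite subUset sub1 andbT.
by rewrite -(eq_porbit (subsetP sub1 y (porbit_id s y))) tpermC.
Qed.

Lemma card_porbit_tperm_merge s x y :
  x \notin porbit s y ->
  #|porbit (tperm x y * s) x| = #|porbit s x| + #|porbit s y|.
Proof.
move=> xNy; rewrite porbit_tperm_merge // cardsU.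
suff -> : porbit s x :&: porbit s y = set0 by rewrite cards0 subn0.
apply/setP=> w; rewrite !inE; apply: contraNF xNy => /andP[wx wy].
by rewrite -(eq_porbit wy) porbit_sym.
Qed.

(** The transposition exchanges the successors of [x] and [y]. This cuts the cycle into two arcs:
    positions [1] to [i], ending at [y], and positions [i + 1] to [n], ending at [x]. *)
Lemma porbit_tperm_split s x i (n := #|porbit s x|) (y := (s ^+ i) x) :
    0 < i < n ->
  [/\ #|porbit (tperm x y * s) y| = i, #|porbit (tperm x y * s) x| = n - i &
      forall w, w \in porbit s x ->
        #|porbit (tperm x y * s) w| = i \/ #|porbit (tperm x y * s) w| = n - i].
Proof.
move=> /andP[i_gt0 lt_in]; set u := tperm x y * s.
have inj := @porbit_expg_inj s x; rewrite -/n in inj.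
have sy j : (s ^+ j) y = (s ^+ (i + j)) x by rewrite perm_expD.
have neq_x j : 0 < j < n -> (s ^+ j) x != x.
  move=> /andP[j0 jn]; apply/eqP=> e.
  by have := inj j 0 jn (card_porbit_gt0 s x); rewrite expg0 perm1 e => /(_ erefl); lia.
have neq_y j : j < n -> j != i -> (s ^+ j) x != y.
  by move=> jn ji; apply: contraNneq ji => /inj ->.
have uy : u y = s x by rewrite permM tpermR.
have ux : u x = s y by rewrite permM tpermL.
have u1 j : 0 < j < i -> u ((s ^+ j) x) = s ((s ^+ j) x).
  by move=> jj; rewrite permM tpermD // eq_sym ?neq_x ?neq_y //; lia.
have u2 j : 0 < j < n - i -> u ((s ^+ j) y) = s ((s ^+ j) y).
  by move=> jj; rewrite sy permM tpermD // eq_sym ?neq_x ?neq_y //; lia.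
have c1 : #|porbit u y| = i.
  by apply: card_porbit_detour uy u1 i_gt0 _ _ => // j jj; rewrite neq_y //; lia.
have c2 : #|porbit u x| = n - i.
  apply: card_porbit_detour ux u2 _ _ _; rewrite ?subn_gt0 //.
    by rewrite sy subnKC ?expg_card_porbit // ltnW.
  by move=> j jj; rewrite sy neq_x //; lia.
split=> // w /porbitPlt[j ltj ->].
(* Position [0] is [x], which ends the second arc. *)
have [->|j_gt0] := posnP j; first by rewrite expg0 perm1; right.
have [leji|ltij] := leqP j i.
  by left; rewrite -c1 -(detour_expg uy u1) ?porbit_perm ?j_gt0.
right; rewrite -c2 -(subnKC (ltnW ltij)) -sy -(detour_expg ux u2) ?porbit_perm //.
by rewrite -/n in ltj; lia.
Qed.

End Orbits.

(** * Six twisted products that cannot all be conjugate *)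

Section TwistedOrbits.

Variable T : finType.
Implicit Types (s u g r : {perm T}) (x y z w a b c d : T) (O : {set T}).

Lemma porbit_notin_trans s x y z :
  x \in porbit s y -> z \notin porbit s y -> x \notin porbit s z.
Proof.
by move=> xy; apply: contra => xz; rewrite -(eq_porbit xy) porbit_sym.
Qed.

(** A transposition changes the number of cycles by one, upwards exactly when its two points share a
    cycle; conjugation preserves that number. *)
Lemma tperm_conj_same_porbit s g x y z w :
    x != y -> z != w -> tperm x y * s = (tperm z w * s) ^ g ->
  (x \in porbit s y) = (z \in porbit s w).
Proof.
move=> xy zw e; have:= porbits_mul_tperm s z w; have:= porbits_mul_tperm s x y.
rewrite /= e card_porbitsJ xy zw.
by case: (x \in _); case: (z \in _) => //=; lia.
Qed.

Lemma tperm_split_spectrum s a i j (n := #|porbit s a|) :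
    i < j < n -> let u := tperm ((s ^+ i) a) ((s ^+ j) a) * s in
  (exists2 w, w \in porbit s a & #|porbit u w| = j - i) /\
  (forall w, w \in porbit s a ->
     #|porbit u w| = j - i \/ #|porbit u w| = n - (j - i)).
Proof.
move=> ijn u; have e : (s ^+ j) a = (s ^+ (j - i)) ((s ^+ i) a).
  by rewrite -perm_expD subnKC //; lia.
have eO := porbit_perm s i a; have := @porbit_tperm_split _ s ((s ^+ i) a) (j - i).
rewrite eO -e -/n -/u => [[|c1 c2 c3]]; first by lia.
by split=> //; exists ((s ^+ j) a); rewrite ?mem_porbit.
Qed.

(** With truncated subtraction, [d] and [d'] are absolute differences. Both products agree off the
    cycle of [a], so the arc length [d] must be one of the arc lengths [d'] and [n - d']. *)
Lemma tperm_conj_spacing s g a i j i' j' (n := #|porbit s a|)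
    (d := (i - j) + (j - i)) (d' := (i' - j') + (j' - i')) :
    i < n -> j < n -> i' < n -> j' < n -> i != j -> i' != j' ->
    tperm ((s ^+ i) a) ((s ^+ j) a) * s
      = (tperm ((s ^+ i') a) ((s ^+ j') a) * s) ^ g ->
  d = d' \/ d + d' = n.
Proof.
move=> + + + +; rewrite {}/d {}/d'.
wlog ltij : i j / i < j => [hw|].
  have [|leji] := ltnP i j; first exact: hw.
  by move=> ? ? ? ? ? ?; rewrite tpermC addnC; apply: hw => //; lia.
wlog ltij' : i' j' / i' < j' => [hw|].
  have [|leji'] := ltnP i' j'; first exact: hw.
  move=> ? ? ? ? ? ?; rewrite [X in (X * _) ^ _]tpermC [i' - j' + _]addnC.
  by apply: hw => //; lia.
move=> _ ltj _ ltj' _ _ e.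
have [|[w Ow cw] _] := @tperm_split_spectrum s a i j; first by rewrite ltij.
have [|_ sp] := @tperm_split_spectrum s a i' j'; first by rewrite ltij'.
have [z|y Oy] := card_porbit_transfer e _ Ow.
  move=> Oz; rewrite !porbit_tperm_out //;
    by apply: porbit_notin_trans Oz; rewrite mem_porbit.
rewrite cw => cy; have [] := sp y Oy; rewrite cy -/n in ltj' *; lia.
Qed.

Lemma card_porbit_tperm_merge3 s x y z :
    x \notin porbit s y -> x \notin porbit s z -> y \notin porbit s z ->
    forall w, w \in porbit s x :|: porbit s y :|: porbit s z ->
  #|porbit (tperm x y * s) w| = #|porbit s x| + #|porbit s y| \/
  #|porbit (tperm x y * s) w| = #|porbit s z|.
Proof.
move=> xy xz yz w; rewrite inE -porbit_tperm_merge // => /orP[] wO; [left|right].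
  by rewrite -card_porbit_tperm_merge // (eq_porbit wO).
by rewrite porbit_tperm_out (eq_porbit wO).
Qed.

(** The product with [(x y)] keeps the cycle of [z], so its length recurs in the product with
    [(x z)]. The candidates there are the merged length, which is too large, and the length of the
    cycle of [y]. *)
Lemma tperm_conj_card_porbit s g x y z :
    x \notin porbit s y -> x \notin porbit s z -> y \notin porbit s z ->
    tperm x y * s = (tperm x z * s) ^ g ->
  #|porbit s y| = #|porbit s z|.
Proof.
move=> xy xz yz e; pose O := porbit s x :|: porbit s y :|: porbit s z.
have [w||w Ow] := @card_porbit_transfer _ _ _ _ O z e.
- rewrite !inE !negb_or => /andP[/andP[wx wy] wz].
  by rewrite !porbit_tperm_out // porbit_sym.
- by rewrite !inE porbit_id orbT.
rewrite [porbit (tperm _ _ * s) z]porbit_tperm_out // => cw.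
have zy : z \notin porbit s y by rewrite porbit_sym.
have := @card_porbit_tperm_merge3 s x z y xz xy zy w.
rewrite setUAC => /(_ Ow); rewrite cw.
by have := card_porbit_gt0 s x; lia.
Qed.

Lemma class_setT_conj (gT : finGroupType) (p q r : gT) :
  p \in r ^: [set: gT] -> q \in r ^: [set: gT] -> exists g : gT, p = q ^ g.
Proof.
by move=> /imsetP[g _ ->] /imsetP[h _ ->]; exists (h^-1 * g); rewrite conjgM conjgK.
Qed.

(* On a circle of length [n], three points at equal distances split it into
   thirds, so there is no room for [l] besides [0], [i] and [j]. *)
Lemma no_four_equidistant (n i j l : nat) (D := fun m m' : nat => (m - m') + (m' - m)) :
    i < n -> j < n -> l < n -> 0 < i -> i != j -> 0 < l ->
    D 0 j = i \/ D 0 j + i = n -> D i j = i \/ D i j + i = n ->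
    D i l = i \/ D i l + i = n -> D j l = i \/ D j l + i = n ->
  i = l \/ j = l.
Proof. rewrite {}/D => ? ? ? ? ? ? [?|?] [?|?] [?|?] [?|?]; lia. Qed.

(** Composed from left to right, the three transpositions at [d] form the 4-cycle [(d c b a)]. The
    nested form lets cycles be merged one at a time. *)
Lemma twisted_transpositions_not_conjugate s r a b c d (K := r ^: [set: {perm T}]) :
    uniq [:: a; b; c; d] ->
    tperm a b * s \in K -> tperm a c * s \in K ->
    tperm b c * s \in K -> tperm b d * s \in K ->
    tperm c d * s \in K ->
  tperm d c * (tperm d b * (tperm d a * s)) \notin K.
Proof.
rewrite /= !inE !negb_or => /and4P[/and3P[ab ac ad] /andP[bc bd] cd _].
move=> Kab Kac Kbc Kbd Kcd; apply/negP => Kx.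
have same x y : x != y -> tperm x y * s \in K ->
    (x \in porbit s y) = (a \in porbit s b).
  move=> xy Kxy; have [g e] := class_setT_conj Kxy Kab.
  exact: tperm_conj_same_porbit e.
have sac := same _ _ ac Kac; have sbc := same _ _ bc Kbc.
have sbd := same _ _ bd Kbd; have scd := same _ _ cd Kcd.
have [sab|dab] := boolP (a \in porbit s b).
  rewrite sab in sac sbc sbd scd => {same}.
  have Oa x : x \in porbit s a -> exists2 i, i < #|porbit s a| & x = (s ^+ i) a.
    exact: porbitPlt.
  have [i lti eb] : exists2 i, i < #|porbit s a| & b = (s ^+ i) a.
    by apply: Oa; rewrite porbit_sym.
  have [j ltj ec] : exists2 i, i < #|porbit s a| & c = (s ^+ i) a.
    by apply: Oa; rewrite porbit_sym.
  have [l ltl ed] : exists2 i, i < #|porbit s a| & d = (s ^+ i) a.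
    by apply: Oa; rewrite porbit_sym -(eq_porbit sbd).
  have ea : a = (s ^+ 0) a by rewrite expg0 perm1.
  have lt0 := card_porbit_gt0 s a.
  have neq m m' : (s ^+ m) a != (s ^+ m') a -> m != m'.
    by apply: contraNneq => ->.
  have n0i : 0%N != i by apply: neq; rewrite -ea -eb.
  have n0j : 0%N != j by apply: neq; rewrite -ea -ec.
  have n0l : 0%N != l by apply: neq; rewrite -ea -ed.
  have nij : i != j by apply: neq; rewrite -eb -ec.
  have nil : i != l by apply: neq; rewrite -eb -ed.
  have njl : j != l by apply: neq; rewrite -ec -ed.
  (* Every spacing is compared with [i], the spacing of [a] and [b]. *)
  have link m m' : m < #|porbit s a| -> m' < #|porbit s a| -> m != m' ->
      tperm ((s ^+ m) a) ((s ^+ m') a) * s \in K ->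
      ((m - m') + (m' - m) = i \/ (m - m') + (m' - m) + i = #|porbit s a|)%N.
    move=> ltm ltm' nm Km.
    have [|g e] := class_setT_conj (q := tperm ((s ^+ 0) a) ((s ^+ i) a) * s) Km.
      by rewrite -ea -eb.
    by have := tperm_conj_spacing ltm ltm' lt0 lti nm n0i e; rewrite sub0n subn0.
  have l1 : _ := link 0%N j lt0 ltj n0j; rewrite -ea -ec in l1.
  have l2 : _ := link i j lti ltj nij; rewrite -eb -ec in l2.
  have l3 : _ := link i l lti ltl nil; rewrite -eb -ed in l3.
  have l4 : _ := link j l ltj ltl njl; rewrite -ec -ed in l4.
  rewrite !(eq_sym 0%N) -!lt0n in n0i n0l.
  have := no_four_equidistant lti ltj ltl n0i nij n0l.
  case/(_ (l1 Kac) (l2 Kbc) (l3 Kbd) (l4 Kcd)) => e; first by rewrite e eqxx in nil.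
  by rewrite e eqxx in njl.
rewrite (negPf dab) in sac sbc sbd scd => {same}.
have dac := negbT sac; have dbc := negbT sbc.
have dbd := negbT sbd; have dcd := negbT scd.
(* [(a d)] is not among the five transpositions, so [a] and [d] may still share a cycle. *)
have [sad|dad] := boolP (a \in porbit s d).
  have Lbc : #|porbit s b| = #|porbit s c|.
    by have [g e] := class_setT_conj Kab Kac; apply: tperm_conj_card_porbit e.
  have Lac : #|porbit s a| = #|porbit s c|.
    have [g e] := class_setT_conj Kab Kbc; rewrite tpermC in e.
    by apply: tperm_conj_card_porbit e; rewrite // porbit_sym.
  have [i lti ea] := porbitPlt sad.
  have cardd : #|porbit s d| = #|porbit s a|.
    by rewrite (eq_porbit sad).
  have i_gt0 : 0 < i.
    by rewrite lt0n; apply: contraNneq ad => i0; rewrite ea i0 expg0 perm1.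
  set u := tperm d c * _ in Kx.
  (* [u] sends [a] to [s d] and then follows the cycle of [d], returning to [a] after [i] steps in
     all. *)
  have ca : #|porbit u a| = i.
    have neq j x : x \notin porbit s d -> x != (s ^+ j) d.
      by apply: contraNneq => ->; rewrite mem_porbit.
    have neqa j : 0 < j < i -> (s ^+ j) d != a.
      move=> jj; rewrite ea; apply/eqP=> e.
      have ltj : j < #|porbit s d| by apply: ltn_trans lti; case/andP: jj.
      by move: jj; rewrite (porbit_expg_inj ltj lti e) ltnn andbF.
    apply: (@card_porbit_detour _ s u d a i) => //.
      rewrite /u !permM (tpermD (x := d) (y := c)) 1?eq_sym //.
      by rewrite (tpermD (x := d) (y := b)) 1?eq_sym // tpermR.
    move=> j jj; have neqd : d != (s ^+ j) d.
      apply/eqP=> e; have ltj : j < #|porbit s d| by apply: ltn_trans lti; case/andP: jj.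
      have := porbit_expg_inj (card_porbit_gt0 s d) ltj.
      by rewrite expg0 perm1 => /(_ e) j0; rewrite -j0 in jj.
    have neqaj : a != (s ^+ j) d by rewrite eq_sym neqa.
    by rewrite /u !permM !(tpermD neqd) // neq.
  have [g e] := class_setT_conj Kx Kab.
  pose O := porbit s a :|: porbit s b :|: porbit s c.
  have [w||w Ow] := @card_porbit_transfer _ _ _ _ O a e.
  - rewrite !inE !negb_or => /andP[/andP[wa wb] wc].
    have wd : w \notin porbit s d by rewrite -(eq_porbit sad).
    by rewrite /u !porbit_tperm_out // porbit_sym.
  - by rewrite !inE porbit_id.
  (* Let [L] be the common length of the cycles of [a], [b], [c]. Within [O] the cycles of [(a b)s]
     have length [2L] or [L], whereas [i < L]. *)
  rewrite ca => cw; have := card_porbit_tperm_merge3 dab dac dbc Ow.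
  rewrite cw Lbc Lac => -[] ei; move: lti; rewrite ei cardd Lac ?ltnn //.
  by rewrite ltnNge leq_addr.
have dda : d \notin porbit s a by rewrite porbit_sym.
have ddb : d \notin porbit s b by rewrite porbit_sym.
have ddc : d \notin porbit s c by rewrite porbit_sym.
pose O := porbit s d :|: porbit s a :|: porbit s b :|: porbit s c.
set u := tperm d c * _ in Kx.
have uO : porbit u d = O.
  have e1 := porbit_tperm_merge dda.
  have e2 : porbit (tperm d b * (tperm d a * s)) d
             = porbit s d :|: porbit s a :|: porbit s b.
    rewrite porbit_tperm_merge; first by rewrite e1 [porbit _ b]porbit_tperm_out.
    by rewrite porbit_tperm_out.
  rewrite porbit_tperm_merge; 
    first by rewrite e2 [porbit _ c]porbit_tperm_out ?[porbit _ c]porbit_tperm_out.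
  by rewrite !porbit_tperm_out.
have [g e] := class_setT_conj Kab Kx.
have [w||w Ow] := @card_porbit_transfer _ _ _ _ O c e.
- rewrite !inE !negb_or => /andP[/andP[/andP[wd wa] wb] wc].
  by rewrite /u !porbit_tperm_out // porbit_sym.
- by rewrite !inE porbit_id !orbT.
(* [(a b)s] keeps the cycle of [c], which is strictly smaller than the single cycle [O] of [u]. *)
rewrite [porbit (tperm _ _ * s) c]porbit_tperm_out //.
rewrite (@eq_porbit _ u w d) uO //.
have : porbit s c \proper O.
  by rewrite properE subsetUr; apply/subsetPn; exists d; rewrite // !inE porbit_id.
by move=> /proper_card + e'; rewrite e' ltnn.
Qed.

End TwistedOrbits.

(** * Relations between transpositions, and products along a path *)

Section PathProducts.

Variable T : finType.
Implicit Types (x y z : T) (p : seq T) (q : {perm T}).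

Lemma mulg_tperm q x y : q * tperm (q x) (q y) = tperm x y * q.
Proof. by rewrite -tpermJ -conjgC. Qed.

Lemma tperm_slide x y z :
  x != z -> y != z -> tperm x y * tperm x z = tperm y z * tperm x y.
Proof.
by move=> xz yz; have := mulg_tperm (tperm x y) y z; rewrite tpermR tpermD.
Qed.

Lemma tperm_sandwich x y z :
  x != z -> y != z -> tperm y z * (tperm x y * tperm x z) = tperm x y.
Proof. by move=> xz yz; rewrite tperm_slide // mulgA tperm2 mul1g. Qed.

Lemma tperm_neq_fix x y q : x != y -> q x = x -> tperm x y != q.
Proof. by move=> xy qx; apply: contraNneq xy => e; rewrite -{1}qx -e tpermL. Qed.

(** [pairmap tperm x p] lists the edges of the path [x :: p] as transpositions, and each moves only
    its own endpoints. *)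
Lemma pairmap_tperm_fix x p z q :
  z \notin x :: p -> q \in pairmap tperm x p -> q z = z.
Proof.
elim: p x => //= y p IHp x; rewrite !inE !negb_or => /and3P[zx zy zp].
case/predU1P=> [->|]; first by rewrite tpermD // eq_sym.
by apply: IHp; rewrite inE negb_or zy.
Qed.

(** The first edge moves [x], whereas all later edges fix it. *)
Lemma uniq_pairmap_tperm x p : uniq (x :: p) -> uniq (pairmap tperm x p).
Proof.
elim: p x => //= y p IHp x /andP[xp Up]; rewrite IHp // andbT.
apply/negP=> /(pairmap_tperm_fix xp); rewrite tpermL => e.
by rewrite -e mem_head in xp.
Qed.

Lemma prod_pairmap_tperm_last x p : (\prod_(q <- pairmap tperm x p) q) x = last x p.
Proof.
by elim: p x => [|y p IHp] x /=; rewrite ?big_nil ?perm1 // big_cons permM tpermL.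
Qed.

Lemma prod_perm_fix (s : seq {perm T}) z :
  (forall q, q \in s -> q z = z) -> (\prod_(q <- s) q) z = z.
Proof.
move=> fix_z; rewrite big_seq; elim/big_rec: _ => [|q u sq uz]; first exact: perm1.
by rewrite permM fix_z.
Qed.

End PathProducts.

(** [rem] deletes one occurrence at a time, and distinctness of the entries of [s] keeps the later
    ones available. *)
Lemma sub_uniq_perm_cat (T : eqType) (s t : seq T) :
  uniq s -> {subset s <= t} -> exists u, perm_eq (s ++ u) t.
Proof.
elim: s t => [|x s IHs] t /=; first by exists t.
case/andP=> xs Us st; have tx : x \in t by rewrite st ?mem_head.
have [y sy|u su] := IHs (rem x t) Us.
  have := st y; rewrite (perm_mem (perm_to_rem tx)) !inE sy orbT.
  by case/(_ isT)/predU1P=> [yx|//]; rewrite -yx sy in xs.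
by exists u; rewrite perm_sym (permPl (perm_to_rem tx)) /= perm_cons perm_sym.
Qed.

(** * Rearrangements around a triangle with a further edge and around a longer circuit *)

Section Invariance.

Variables (k : nat) (f : seq 'S_k).
Hypothesis f_inv : conjugacy_invariant f.

Lemma mem_composite_class (w : seq 'S_k) p :
  perm_eq w f -> p = composite w -> p \in composite f ^: [set: 'S_k].
Proof.
move=> wf pw; have [|g ->] := f_inv (p := p); first by exists w.
by rewrite imset_f ?inE.
Qed.

Ltac rearrange e :=
  by apply/seq.permP=> P; rewrite -(seq.permP e) /= ?count_cat /=; repeat nat_congr.

Lemma triangle_edge_not_conjugacy_invariant a b c d :
    uniq [:: a; b; c; d] ->
  ~ {subset [:: tperm a b; tperm a c; tperm b c; tperm a d] <= f}.
Proof.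
move=> Uabcd sub_f; have:= Uabcd; rewrite /= !inE !negb_or.
case/and4P=> [/and3P[ab ac ad] /andP[bc bd] cd _].
(* [D] keeps any further copies of the four edges. *)
have [|D eqf] := sub_uniq_perm_cat _ sub_f.
  rewrite /= !inE !negb_or !andbT -!andbA; apply/and5P; split; last (apply/andP; split).
  - by rewrite tpermC tperm_neq_fix ?tpermD // eq_sym.
  - by rewrite tperm_neq_fix ?tpermD // eq_sym.
  - by rewrite tpermC tperm_neq_fix ?tpermD // eq_sym.
  - by rewrite tperm_neq_fix ?tpermD // eq_sym.
  - by rewrite tpermC tperm_neq_fix ?tpermD // eq_sym.
  - by rewrite tperm_neq_fix ?tpermD // eq_sym.
pose s := tperm a d * composite D.
have := twisted_transpositions_not_conjugate (s := s) (r := composite f) Uabcd.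
have tri1 := tperm_sandwich ac bc.
have tri2 : tperm a b * (tperm a c * tperm b c) = tperm a c.
  by rewrite [tperm a c]tpermC [tperm b c]tpermC tperm_sandwich // eq_sym.
have tri3 : tperm a b * (tperm b c * tperm a c) = tperm b c.
  by rewrite [tperm a c]tpermC [tperm b c]tpermC [tperm a b]tpermC tperm_sandwich // eq_sym.
(* A leading [(a d)] turns the middle edge [(a b)] or [(a c)] into [(b d)] or [(c d)], which gives
   the two products involving [d]. *)
have slideb : tperm a d * tperm a b = tperm b d * tperm a d.
  by rewrite tperm_slide 1?tpermC // eq_sym.
have slidec : tperm a d * tperm a c = tperm c d * tperm a d.
  by rewrite tperm_slide 1?tpermC // eq_sym.
case/(_ _ _ _ _ _)/negP.
- apply: (mem_composite_class (w := [:: tperm b c, tperm a b, tperm a c, tperm a d & D]));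
    first by rearrange eqf.
  by rewrite /composite !big_cons -[in LHS]tri1 !mulgA.
- apply: (mem_composite_class (w := [:: tperm a b, tperm a c, tperm b c, tperm a d & D]));
    first by rearrange eqf.
  by rewrite /composite !big_cons -[in LHS]tri2 !mulgA.
- apply: (mem_composite_class (w := [:: tperm a b, tperm b c, tperm a c, tperm a d & D]));
    first by rearrange eqf.
  by rewrite /composite !big_cons -[in LHS]tri3 !mulgA.
- apply: (mem_composite_class (w := [:: tperm a d, tperm b c, tperm a b, tperm a c & D]));
    first by rearrange eqf.
  rewrite /composite !big_cons mulgA -slideb -[in LHS]tri1 !mulgA //.
- apply: (mem_composite_class (w := [:: tperm a d, tperm a b, tperm a c, tperm b c & D]));
    first by rearrange eqf.
  rewrite /composite !big_cons mulgA -slidec -[in LHS]tri2 !mulgA //.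
(* The factor [(d a)] cancels the leading [(a d)] of [s], so the target is [(d c)(d b)D], that is
   [(b d)(b c)D]. *)
apply: (mem_composite_class (w := [:: tperm a b, tperm a d, tperm b c, tperm a c & D]));
    first by rearrange eqf.
rewrite /composite !big_cons /s [tperm d a]tpermC tpermKg !mulgA; congr (_ * _).
have -> : tperm d c * tperm d b = tperm b d * tperm b c.
  by rewrite [tperm d b]tpermC tperm_slide // eq_sym.
have -> : tperm a b * tperm a d = tperm b d * tperm a b by rewrite tperm_slide.
by rewrite -!mulgA tri3.
Qed.

(* The rest of the circuit only enters through its product [rho], which sends
   [d] to [a] and fixes [b] and [c]. *)
Lemma long_circuit_not_conjugacy_invariant a b c d (r : seq 'I_k) :
    uniq [:: a, b, c, d & r] ->
  ~ {subset pairmap tperm a [:: b, c, d & rcons r a] <= f}.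
Proof.
move=> Ur sub_f; have Uabcd : uniq [:: a; b; c; d].
  by move: Ur; rewrite -[_ :: _]/([:: a; b; c; d] ++ r) cat_uniq => /andP[].
have:= Uabcd; rewrite /= !inE !negb_or.
case/and4P=> [/and3P[ab ac ad] /andP[bc bd] cd _].
(* Started at [b], the path to [a] repeats no vertex, so its edges are distinct; only [(a b)]
   remains to be separated from them. *)
have Up : uniq [:: b, c, d & rcons r a].
  by rewrite -[_ :: _]/(rcons [:: b, c, d & r] a) -rot1_cons rot_uniq.
pose es := pairmap tperm d (rcons r a).
change {subset [:: tperm a b, tperm b c, tperm c d & es] <= f} in sub_f.
have [bp cp] : b \notin d :: rcons r a /\ c \notin d :: rcons r a.
  move: Up; rewrite /= !inE !negb_or.
  by case/and3P=> /and3P[_ bd' br] /andP[cd' cr] _; rewrite bd' cd'.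
have [|D eqf] := sub_uniq_perm_cat _ sub_f.
  have := uniq_pairmap_tperm Up; rewrite /= -/es => ->; rewrite andbT !inE !negb_or.
  apply/and3P; split.
  - by rewrite tperm_neq_fix ?tpermD // eq_sym.
  - by rewrite tperm_neq_fix ?tpermD // eq_sym.
  - apply/negP=> /(pairmap_tperm_fix bp); rewrite tpermR => e.
    by rewrite e eqxx in ab.
pose rho := composite es.
have rho_d : rho d = a by rewrite /rho /composite prod_pairmap_tperm_last last_rcons.
have rho_b : rho b = b by apply: prod_perm_fix => q; apply: pairmap_tperm_fix.
have rho_c : rho c = c by apply: prod_perm_fix => q; apply: pairmap_tperm_fix.
(* Carried leftwards across [rho], [(a b)] becomes [(b d)], which need not be an edge. Words with
   [(a b)] placed after [es] exploit this. *)
have rho_ab : rho * tperm a b = tperm b d * rho.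
  by rewrite -{1}rho_d -{1}rho_b mulg_tperm tpermC.
have rho_bc : rho * tperm b c = tperm b c * rho.
  by rewrite -{1}rho_b -{1}rho_c mulg_tperm.
pose s := tperm b c * tperm c d * rho * composite D.
have := twisted_transpositions_not_conjugate (s := s) (r := composite f) Uabcd.
have sl1 : tperm c d * tperm b d = tperm b c * tperm c d.
  by rewrite [tperm c d]tpermC [tperm b d]tpermC tperm_slide 1?[tperm c b]tpermC // eq_sym.
have sl2 : tperm b c * tperm b d = tperm c d * tperm b c by rewrite tperm_slide.
have sl3 : tperm b d * tperm b c = tperm c d * tperm b d.
  by rewrite tperm_slide 1?[tperm d c]tpermC // eq_sym.
have sl4 : tperm b c * tperm c d = tperm b d * tperm b c.
  by rewrite [tperm b c]tpermC tperm_slide.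
have sl5 : tperm b c * tperm a b = tperm a c * tperm b c.
  by rewrite [tperm a b]tpermC tperm_slide 1?[tperm c a]tpermC // eq_sym.
case/(_ _ _ _ _ _)/negP.
- apply: (mem_composite_class (w := [:: tperm a b, tperm b c, tperm c d & es ++ D]));
    first by rearrange eqf.
  by rewrite /composite !big_cons big_cat /= !mulgA.
- apply: (mem_composite_class (w := [:: tperm b c, tperm a b, tperm c d & es ++ D]));
    first by rearrange eqf.
  by rewrite /composite !big_cons big_cat /= !mulgA sl5.
- apply: (mem_composite_class (w := [:: tperm b c, tperm c d & es ++ tperm a b :: D]));
    first by rearrange eqf.
  rewrite /composite !big_cons big_cat /= big_cons -/(composite es) -/rho -/(composite D).
  by rewrite [rho * _]mulgA rho_ab /s !mulgA; congr (_ * rho * _); rewrite -!mulgA sl1.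
- apply: (mem_composite_class (w := [:: tperm c d, tperm b c & es ++ tperm a b :: D]));
    first by rearrange eqf.
  rewrite /composite !big_cons big_cat /= big_cons -/(composite es) -/rho -/(composite D).
  rewrite [rho * _]mulgA rho_ab /s !mulgA; congr (_ * rho * _).
  by rewrite -sl4 -!mulgA sl2 tperm2 mulg1 mulgA tperm2 mul1g.
- apply: (mem_composite_class (w := [:: tperm c d & es ++ [:: tperm a b, tperm b c & D]]));
    first by rearrange eqf.
  rewrite /composite !big_cons big_cat /= !big_cons -/(composite es) -/rho -/(composite D).
  rewrite !mulgA -[_ * rho * tperm a b]mulgA rho_ab.
  rewrite !mulgA -[_ * rho * tperm b c]mulgA rho_bc !mulgA.
  by congr (_ * rho * _); rewrite -!mulgA sl4.
(* Here [(d b)(d a) = (a b)(b d)] and [(b c)(c d) = (b d)(b c)], so the two factors [(b d)]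
   cancel. *)
apply: (mem_composite_class (w := [:: tperm a b, tperm c d, tperm b c & es ++ D]));
    first by rearrange eqf.
rewrite /composite !big_cons big_cat /= /s !mulgA; congr (_ * _ * _).
have sl6 : tperm d b * tperm d a = tperm a b * tperm b d.
  by rewrite tperm_slide 1?[tperm b a]tpermC 1?[tperm d b]tpermC // eq_sym.
have comm : tperm d c * tperm a b = tperm a b * tperm c d.
  have := mulg_tperm (tperm c d) a b.
  by rewrite !tpermD 1?eq_sym // [tperm d c]tpermC.
rewrite -[_ * tperm d b * _]mulgA sl6 -!mulgA sl4 [tperm b d * (_ * _)]mulgA.
by rewrite tperm2 mul1g [RHS]mulgA -comm mulgA.
Qed.

End Invariance.

(** * From circuits of the multigraph to terms of the sequence *)

Lemma adj_tmultP k (f : seq 'S_k) x y :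
  adj (transpositional_multigraph f) x y -> x != y /\ tperm x y \in f.
Proof.
by rewrite /adj /= /tmult; case: eqP => // /eqP xy; rewrite -has_count has_pred1.
Qed.

Lemma path_pairmap_tperm k (f : seq 'S_k) x p :
  path (adj (transpositional_multigraph f)) x p -> {subset pairmap tperm x p <= f}.
Proof.
elim: p x => //= y p IHp x /andP[/adj_tmultP[_ fxy] pth] q.
by case/predU1P=> [->//|]; apply: IHp.
Qed.

(** If no edge left [S], then [S] would be closed under adjacency and so a union of components. *)
Lemma connected_exit (V : finType) (G : multigraph V) (S : {set V}) x y :
    connected G -> x \in S -> y \notin S ->
  exists v w, [/\ v \in S, w \notin S & adj G v w].
Proof.
move=> conG Sx Sy.
have [/existsP[v /existsP[w /and3P[? ? ?]]]|none] :=
  boolP [exists v, exists w, [&& v \in S, w \notin S & adj G v w]]; first by exists v, w.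
have out v w : v \in S -> adj G v w -> w \in S.
  move=> Sv vw; apply: contraNT none => Sw.
  by apply/existsP; exists v; apply/existsP; exists w; rewrite Sv Sw vw.
have clS : closed (adj G) S.
  move=> v w vw; apply/idP/idP => [/out|/out]; first exact.
  by apply; rewrite /adj /= mult_sym.
by have := closed_connect clS (conG x y); rewrite Sx (negPf Sy).
Qed.

Theorem theorem3p18 (k : nat) (f : seq 'S_k) :
  4 <= k ->
  (forall p : 'S_k, p \in f -> transposition p) ->
  connected (transpositional_multigraph f) ->
  contains_circuit (transpositional_multigraph f) ->
  ~ conjugacy_invariant f.
Proof.
move=> k4 _ conf [cyc [sz /andP[]]] + + f_inv.
case: cyc sz => [|a [|b [|c [|d r]]]] // _ cyc_abc uniq_abc.
  (* A triangle misses some vertex because [4 <= k], so connectedness gives an edge from it to an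
     outside vertex [d]. *)
  move: cyc_abc; rewrite /= andbT => /and3P[].
  move=> /adj_tmultP[ab fab] /adj_tmultP[bc fbc] /adj_tmultP[ca fca].
  pose S := [set x in [:: a; b; c]].
  have [y Sy] : exists y, y \notin S.
    apply/existsP; rewrite -negb_forall; apply: contraL k4 => /forallP allS.
    have -> : k = #|S|.
      by rewrite -[LHS]card_ord -cardsT; apply: eq_card => z; rewrite allS inE.
    by rewrite -ltnNge ltnS cardsE card_size.
  have Sa : a \in S by rewrite !inE eqxx.
  have [v [d [Sv Sd /adj_tmultP[vd fvd]]]] := connected_exit conf Sa Sy.
  have Sdn x : x \in S -> x != d by move=> Sx; apply: contraNneq Sd => <-.
  have [da db dc] : [/\ a != d, b != d & c != d].
    by split; apply: Sdn; rewrite !inE eqxx ?orbT.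
  (* The outgoing edge may start at any corner, so the corners are relabelled cyclically. *)
  have apex x y' z : x != y' -> y' != z -> z != x -> x != d -> y' != d -> z != d ->
      tperm x y' \in f -> tperm y' z \in f -> tperm z x \in f -> tperm x d \in f -> False.
    move=> xy yz zx xd yd zd fxy fyz fzx fxd.
    apply: (triangle_edge_not_conjugacy_invariant f_inv (a := x) (b := y') (c := z) (d := d)).
      by rewrite /= !inE !negb_or xy yz xd yd zd eq_sym zx.
    by move=> q; rewrite !inE => /or4P[]/eqP-> //; rewrite tpermC.
  move: Sv; rewrite !inE => /or3P[]/eqP ev; subst v.
  - exact: (apex a b c).
  - exact: (apex b c a).
  - exact: (apex c a b).
(* The remaining circuits have at least four vertices, the first four serving as [a], [b], [c],
   [d]. *)
apply: (long_circuit_not_conjugacy_invariant f_inv uniq_abc).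
exact: path_pairmap_tperm cyc_abc.
Qed.
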